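(* For $n\ge0$ let $p_n$ be the number of positive elements of $F$ whose word length with respect to $\{x_0,x_1\}$ equals $n$, and let $p(x)=\sum_{n\ge0}p_nx^n$. Then $$p(x)=\frac{1-x^2}{1-2x-x^2+x^3}.$$ In particular $p_n=2p_{n-1}+p_{n-2}-p_{n-3}$ for all sufficiently large $n$ (indeed for all $n\ge3$).
   Context: Thompson's group $F=\langle x_0,x_1,x_2,\dots\mid x_nx_k=x_kx_{n+1}\text{ for }k<n\rangle$, generated by $x_0,x_1$ since $x_n=x_0^{1-n}x_1x_0^{n-1}$. An element of $F$ is positive if it lies in the submonoid generated by $x_0,x_1,x_2,\dots$. Word length is in the group $F$ with respect to the generating set $\{x_0,x_1\}$ (words may use $x_0^{\pm1},x_1^{\pm1}$). *)

(* Defs.v *)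
(* Thompson's group F as the group presented by
   < x_0, x_1, ... | x_n x_k = x_k x_{n+1} (k < n) >:
   elements are words in the letters x_i^{+-1} modulo the congruence
   generated by free cancellation and the defining relations. *)
From Stdlib Require Import List ZArith Arith.
Import ListNotations.

(* A letter (i, true) is x_i, (i, false) is x_i^{-1}. *)
Definition letter := (nat * bool)%type.
Definition word := list letter.

Definition inv_letter (a : letter) : letter := (fst a, negb (snd a)).

Inductive Frule : word -> word -> Prop :=
| Frule_cancel : forall a : letter, Frule [a; inv_letter a] []
| Frule_rel : forall n k : nat, k < n ->
    Frule [(n, true); (k, true)] [(k, true); (S n, true)].

Inductive Feq : word -> word -> Prop :=
| Feq_refl : forall w, Feq w w
| Feq_sym : forall w1 w2, Feq w1 w2 -> Feq w2 w1
| Feq_trans : forall w1 w2 w3, Feq w1 w2 -> Feq w2 w3 -> Feq w1 w3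
| Feq_ctx : forall u v w1 w2, Frule w1 w2 -> Feq (u ++ w1 ++ v) (u ++ w2 ++ v).

Definition gen01_word (w : word) : Prop := Forall (fun a => fst a <= 1) w.

Definition word_length (w : word) (n : nat) : Prop :=
  (exists v, gen01_word v /\ length v = n /\ Feq v w) /\
  (forall v, gen01_word v -> Feq v w -> n <= length v).

Definition positive_elt (w : word) : Prop :=
  exists v, Forall (fun a => snd a = true) v /\ Feq v w.

(* The number of elements of F (classes of words modulo Feq) satisfying
   the Feq-invariant property P equals k. *)
Definition num_elements (P : word -> Prop) (k : nat) : Prop :=
  exists l : list word,
    length l = k /\ Forall P l /\
    (forall i j, i < length l -> j < length l ->
        Feq (nth i l []) (nth j l []) -> i = j) /\
    (forall w, P w -> exists u, In u l /\ Feq w u).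

Definition conv (p : nat -> nat) (q : nat -> Z) (n : nat) : Z :=
  fold_right Z.add 0%Z (map (fun i => (Z.of_nat (p i) * q (n - i)%nat)%Z) (seq 0 (S n))).

Definition denom_coef (n : nat) : Z :=
  match n with 0%nat => 1%Z | 1%nat => (-2)%Z | 2%nat => (-1)%Z | 3%nat => 1%Z | _ => 0%Z end.
Definition numer_coef (n : nat) : Z :=
  match n with 0%nat => 1%Z | 2%nat => (-1)%Z | _ => 0%Z end.

(* Main.v *)
(* The element [x_n] joins the trees number [n] and [n+1] of an infinite
   forest of binary trees, and positive elements of [F] correspond to finitely
   supported forests. In terms of [x_0] and [x_1] only, a pointer moves along
   the forest; the word length of a positive element is its number of carets
   plus twice the number of moves of the pointer against its final displacement.

   Lower bound: if [v] is a word in [x_0^{+-1}, x_1^{+-1}] with [v q = p] and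
   [p], [q] positive, then [weight p <= weight q + length v]. One peels
   off the last letter of [v]; if it is [s^{-1}] and [q] is not left divisible
   by [s], one passes to a common multiple [q u = s q'] and uses that
   [weight p + length u <= weight (p u)].

   Counting: a positive element is [1], [g x_0], [g x_1], or the image under
   a bijection raising the length by 2 of an element that is neither [1] nor
   in [F^+ x_0]. Hence [p = 1 + x p + r] and [r = x p + x^2 r]. *)
Require Import Defs.
From Stdlib Require Import List ZArith Arith Lia Setoid Morphisms Cantor.
Import ListNotations.

(** * The congruence [Feq] and index shifts of positive words *)

Global Instance Feq_equivalence : Equivalence Feq.
Proof.
  split; [exact Feq_refl | intros x y; apply Feq_sym
         | intros x y z; apply Feq_trans].
Qed.

Lemma Feq_context u v w1 w2 : Feq w1 w2 -> Feq (u ++ w1 ++ v) (u ++ w2 ++ v).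
Proof.
  induction 1 as [w | w1 w2 _ IH | w1 w2 w3 _ IH1 _ IH2 | a b w1 w2 Hr].
  - reflexivity.
  - now symmetry.
  - now rewrite IH1.
  - assert (E : forall x, u ++ (a ++ x ++ b) ++ v = (u ++ a) ++ x ++ (b ++ v))
      by (intro x; now rewrite !app_assoc).
    rewrite !E. now apply Feq_ctx.
Qed.

Global Instance app_Feq : Proper (Feq ==> Feq ==> Feq) (@app letter).
Proof.
  intros a a' Ha b b' Hb.
  transitivity (a' ++ b).
  - exact (Feq_context [] b _ _ Ha).
  - pose proof (Feq_context a' [] _ _ Hb) as H. now rewrite !app_nil_r in H.
Qed.

Global Instance cons_Feq (a : letter) : Proper (Feq ==> Feq) (cons a).
Proof. intros w w' H. exact (app_Feq [a] [a] (Feq_refl _) _ _ H). Qed.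

Lemma Frule_Feq w1 w2 : Frule w1 w2 -> Feq w1 w2.
Proof.
  intro H. pose proof (Feq_ctx [] [] _ _ H) as E.
  now rewrite !app_nil_r in E.
Qed.

Lemma Feq_cancel a w : Feq (a :: inv_letter a :: w) w.
Proof. exact (app_Feq _ _ (Frule_Feq _ _ (Frule_cancel a)) w w (Feq_refl _)). Qed.

Definition pos (w : list nat) : word := map (fun n => (n, true)) w.

Lemma pos_app u v : pos (u ++ v) = pos u ++ pos v.
Proof. apply map_app. Qed.

Lemma Feq_swap n k w : k < n ->
  Feq ((n, true) :: (k, true) :: w) ((k, true) :: (S n, true) :: w).
Proof.
  intro H. exact (app_Feq _ _ (Frule_Feq _ _ (Frule_rel n k H)) w w (Feq_refl _)).
Qed.

(** The letter x_k travels from the right end to the front, and the defining relation raises by one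
    each index that it passes. *)
Lemma Feq_shift k w : Forall (fun n => k < n) w ->
  Feq (pos (k :: map S w)) (pos (w ++ [k])).
Proof.
  induction 1 as [| n w Hn _ IH]; [reflexivity |].
  cbn in *. rewrite <- Feq_swap by assumption. now rewrite IH.
Qed.

(** The shift for [k = 0] with x_0 moved across. It is the source of spellings that use x_0 and x_1
    only. *)
Lemma Feq_shift_conj w : Forall (fun n => 0 < n) w ->
  Feq (pos (map S w)) ((0, false) :: pos w ++ [(0, true)]).
Proof.
  intro H. rewrite <- (Feq_cancel (0, false) (pos (map S w))).
  apply cons_Feq. pose proof (Feq_shift 0 w H) as E.
  now rewrite pos_app in E.
Qed.

(** * Forests and normal forms of positive words *)

Inductive tree := leaf | node (a b : tree).

(* The generator [x_n] joins the trees [n] and [n+1] of a forest; a word acts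
   from right to left. A list of trees is followed by infinitely many leaves. *)
Definition forest := (tree * list tree)%type.

Fixpoint join (n : nat) (ts : list tree) : list tree :=
  match n with
  | 0 => node (hd leaf ts) (hd leaf (tl ts)) :: tl (tl ts)
  | S n => hd leaf ts :: join n (tl ts)
  end.

Definition act (n : nat) (f : forest) : forest :=
  match n with
  | 0 => (node (fst f) (hd leaf (snd f)), tl (snd f))
  | S n => (fst f, join n (snd f))
  end.

Definition trivial_forest : forest := (leaf, []).

Definition acts (w : list nat) (f : forest) : forest := fold_right act f w.

Lemma acts_app u v f : acts (u ++ v) f = acts u (acts v f).
Proof. apply fold_right_app. Qed.

(** Letters act from the right: [a] is built first and then fills the single position [n], so [b] is
    built at [S n]; the root caret comes last. *)
Fixpoint tree_word (n : nat) (t : tree) : list nat :=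
  match t with
  | leaf => []
  | node a b => n :: tree_word (S n) b ++ tree_word n a
  end.

Fixpoint list_word (n : nat) (ts : list tree) : list nat :=
  match ts with
  | [] => []
  | t :: ts => list_word (S n) ts ++ tree_word n t
  end.

Definition forest_word (f : forest) : list nat :=
  list_word 1 (snd f) ++ tree_word 0 (fst f).

Lemma tree_word_S n t : tree_word (S n) t = map S (tree_word n t).
Proof.
  revert n; induction t as [| a IHa b IHb]; intro n; cbn; [easy |].
  now rewrite map_app, IHa, IHb.
Qed.

Lemma list_word_S n ts : list_word (S n) ts = map S (list_word n ts).
Proof.
  revert n; induction ts as [| t ts IH]; intro n; cbn; [easy |].
  now rewrite map_app, IH, <- tree_word_S.
Qed.

Lemma tree_word_ge n t : Forall (fun i => n <= i) (tree_word n t).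
Proof.
  revert n; induction t as [| a IHa b IHb]; intro n; cbn; [easy |].
  constructor; [easy |]. apply Forall_app; split; [| easy].
  eapply Forall_impl; [| apply IHb]. cbn; lia.
Qed.

Lemma list_word_ge n ts : Forall (fun i => n <= i) (list_word n ts).
Proof.
  revert n; induction ts as [| t ts IH]; intro n; cbn; [easy |].
  apply Forall_app; split; [| apply tree_word_ge].
  eapply Forall_impl; [| apply IH]. cbn; lia.
Qed.

Lemma list_word_shift k n ts : k < n ->
  Feq (pos (k :: list_word (S n) ts)) (pos (list_word n ts ++ [k])).
Proof.
  intro H. rewrite list_word_S. apply Feq_shift.
  eapply Forall_impl; [| apply list_word_ge]. cbn; lia.
Qed.

(** The new letter has to pass the words of all later trees. This lowers their indices by one, which
    is the renumbering caused by merging two trees. *)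
Lemma list_word_join n k ts :
  Feq (pos ((k + n) :: list_word k ts)) (pos (list_word k (join n ts))).
Proof.
  revert k ts; induction n as [| n IH]; intros k ts.
  - rewrite Nat.add_0_r. destruct ts as [| a [| b ts]]; cbn; try reflexivity.
    change ((k, true) :: ?w) with (pos [k] ++ w).
    rewrite <- app_assoc. rewrite pos_app.
    change (Feq (pos (k :: list_word (S (S k)) ts) ++ pos (tree_word (S k) b ++ tree_word k a))
      (pos (list_word (S k) ts ++ k :: tree_word (S k) b ++ tree_word k a))).
    rewrite list_word_shift by lia. rewrite <- pos_app, <- app_assoc. reflexivity.
  - replace (k + S n) with (S k + n) by lia.
    assert (E : list_word k ts = list_word (S k) (tl ts) ++ tree_word k (hd leaf ts))
      by now destruct ts.
    rewrite E. cbn [join list_word]. rewrite app_comm_cons, 2 pos_app.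
    now rewrite IH.
Qed.

Lemma forest_word_act n f : Feq (pos (n :: forest_word f)) (pos (forest_word (act n f))).
Proof.
  destruct f as [t ts].
  pose proof (list_word_join n 0 (t :: ts)) as H. now destruct n.
Qed.

Lemma forest_word_acts w : Feq (pos w) (pos (forest_word (acts w trivial_forest))).
Proof.
  induction w as [| n w IH]; [reflexivity |].
  cbn [acts fold_right]. rewrite <- forest_word_act. cbn. now rewrite IH.
Qed.

(** * Faithfulness of forests *)

(* The Cantor pairing [nat * nat -> nat] is a bijection, so joining entries
   [n] and [n+1] permutes the sequences [nat -> nat] and [F] acts on them. *)
Definition seq_act (a : letter) (s : nat -> nat) (i : nat) : nat :=
  let n := fst a in
  if snd a then
    if i <? n then s i
    else if i =? n then to_nat (s n, s (S n)) else s (S i)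
  else
    if i <? n then s i
    else if i =? n then fst (of_nat (s n))
    else if i =? S n then snd (of_nat (s n)) else s (i - 1).

Definition seq_acts (w : word) (s : nat -> nat) : nat -> nat :=
  fold_right seq_act s w.

Ltac nat_cases :=
  repeat match goal with
  | |- context [?a <? ?b] => destruct (Nat.ltb_spec a b); try lia
  | |- context [?a =? ?b] => destruct (Nat.eqb_spec a b); try lia
  end.

Lemma seq_act_ext a s s' : (forall i, s i = s' i) ->
  forall i, seq_act a s i = seq_act a s' i.
Proof. intros H i. unfold seq_act. now rewrite !H. Qed.

Lemma seq_acts_ext w s s' : (forall i, s i = s' i) ->
  forall i, seq_acts w s i = seq_acts w s' i.
Proof.
  intro H. induction w as [| a w IH]; cbn; [easy |]. now apply seq_act_ext.
Qed.

Lemma seq_acts_app u v s : seq_acts (u ++ v) s = seq_acts u (seq_acts v s).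
Proof. apply fold_right_app. Qed.

Lemma seq_act_cancel a s i : seq_act a (seq_act (inv_letter a) s) i = s i.
Proof.
  destruct a as [n [|]]; unfold seq_act; cbn [inv_letter fst snd negb]; nat_cases;
    first [f_equal; lia
          | rewrite <- surjective_pairing, cancel_to_of; now subst
          | rewrite cancel_of_to; now subst].
Qed.

Lemma seq_act_rel n k s i : k < n ->
  seq_act (n, true) (seq_act (k, true) s) i
  = seq_act (k, true) (seq_act (S n, true) s) i.
Proof. intro H. unfold seq_act; cbn [fst snd]. nat_cases; now subst. Qed.

Lemma seq_acts_Feq w1 w2 : Feq w1 w2 ->
  forall s i, seq_acts w1 s i = seq_acts w2 s i.
Proof.
  induction 1 as [w | w1 w2 _ IH | w1 w2 w3 _ IH1 _ IH2 | u v w1 w2 Hr]; intros s i.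
  - reflexivity.
  - now symmetry.
  - now rewrite IH1.
  - rewrite !seq_acts_app. apply seq_acts_ext. clear i.
    destruct Hr as [a | n k Hk]; intro i.
    + apply seq_act_cancel.
    + now apply seq_act_rel.
Qed.

Fixpoint leaves (t : tree) : nat :=
  match t with leaf => 1 | node a b => leaves a + leaves b end.

(** The iterated Cantor pair that results when the leaves, numbered from [j], carry their number
    plus one. As labels are positive, a node has a larger value than its first leaf, which keeps
    [leaf] and [node] apart. *)
Fixpoint tree_val (j : nat) (t : tree) : nat :=
  match t with
  | leaf => S j
  | node a b => to_nat (tree_val j a, tree_val (j + leaves a) b)
  end.

Fixpoint list_val (j : nat) (ts : list tree) (i : nat) : nat :=
  match ts, i with
  | [], _ => S (j + i)
  | t :: _, 0 => tree_val j t
  | t :: ts, S i => list_val (j + leaves t) ts i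
  end.

Lemma tree_val_gt j t : j < tree_val j t.
Proof.
  revert j; induction t as [| a IHa b IHb]; intro j; cbn [tree_val]; [lia |].
  pose proof (to_nat_non_decreasing (tree_val j a) (tree_val (j + leaves a) b)).
  specialize (IHa j). lia.
Qed.

Lemma tree_val_node_gt j a b : S j < tree_val j (node a b).
Proof.
  cbn [tree_val].
  pose proof (to_nat_non_decreasing (tree_val j a) (tree_val (j + leaves a) b)).
  pose proof (tree_val_gt j a). pose proof (tree_val_gt (j + leaves a) b). lia.
Qed.

Lemma tree_val_inj t t' j : tree_val j t = tree_val j t' -> t = t'.
Proof.
  revert t' j; induction t as [| a IHa b IHb]; intros [| a' b'] j H; [easy | | |].
  - pose proof (tree_val_node_gt j a' b') as G. rewrite <- H in G. cbn in G. lia.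
  - pose proof (tree_val_node_gt j a b) as G. rewrite H in G. cbn in G. lia.
  - cbn [tree_val] in H. apply (f_equal of_nat) in H. rewrite !cancel_of_to in H.
    injection H as Ha Hb. apply IHa in Ha as <-. now apply IHb in Hb as <-.
Qed.

Lemma list_val_inj ts ts' j :
  (forall i, list_val j ts i = list_val j ts' i) ->
  forall i, nth i ts leaf = nth i ts' leaf.
Proof.
  revert ts' j; induction ts as [| t ts IH].
  - induction ts' as [| t' ts' IH']; intros j H i; [easy |].
    assert (t' = leaf) as ->.
    { apply (tree_val_inj _ _ j). specialize (H 0). cbn in *. lia. }
    destruct i as [| i]; [easy |].
    cbn [nth]. transitivity (nth i [] leaf); [now destruct i |].
    apply (IH' (j + 1)).
    intro k. specialize (H (S k)). cbn in *. rewrite <- H. lia.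
  - intros [| t' ts'] j H i.
    + assert (t = leaf) as ->.
      { apply (tree_val_inj _ _ j). specialize (H 0). cbn in *. lia. }
      destruct i as [| i]; [easy |]. cbn [nth].
      transitivity (nth i [] leaf); [| now destruct i].
      apply (IH [] (j + 1)).
      intro k. specialize (H (S k)). cbn in *. rewrite H. lia.
    + pose proof (H 0) as H0. cbn in H0. apply tree_val_inj in H0 as <-.
      destruct i as [| i]; [easy |]. cbn [nth]. apply (IH _ (j + leaves t)).
      intro k. exact (H (S k)).
Qed.

(** The last clause restores the hypothesis of consecutive labels behind the finished tree, so that
    the next tree can be built there. *)
Lemma seq_acts_tree_word t k j s :
  (forall i, s (k + i) = S (j + i)) ->
  let s' := seq_acts (pos (tree_word k t)) s in
  (forall i, i < k -> s' i = s i) /\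
  s' k = tree_val j t /\
  (forall i, s' (S k + i) = S (j + leaves t + i)).
Proof.
  revert k j s; induction t as [| a IHa b IHb]; intros k j s Hs; cbn zeta.
  - cbn. repeat split; intros.
    + rewrite <- (Nat.add_0_r k), Hs. lia.
    + replace (S (k + i)) with (k + S i) by lia. rewrite Hs. lia.
  - cbn [tree_word]. cbn [pos map]. fold (pos (tree_word (S k) b ++ tree_word k a)).
    rewrite pos_app. cbn [seq_acts fold_right].
    fold (seq_acts (pos (tree_word (S k) b) ++ pos (tree_word k a)) s).
    rewrite seq_acts_app.
    destruct (IHa k j s Hs) as (A1 & A2 & A3).
    set (s1 := seq_acts (pos (tree_word k a)) s) in *.
    destruct (IHb (S k) (j + leaves a) s1 A3) as (B1 & B2 & B3).
    set (s2 := seq_acts (pos (tree_word (S k) b)) s1) in *.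
    unfold seq_act; cbn [fst snd]. repeat split.
    + intros i Hi. nat_cases. rewrite B1, A1 by lia. easy.
    + nat_cases. cbn [tree_val]. now rewrite B2, B1, A2 by lia.
    + intro i. nat_cases. change (S (S k + i)) with (S (S k) + i).
      rewrite B3. cbn. lia.
Qed.

Lemma seq_acts_list_word ts k j s :
  (forall i, s (k + i) = S (j + i)) ->
  let s' := seq_acts (pos (list_word k ts)) s in
  (forall i, i < k -> s' i = s i) /\
  (forall i, s' (k + i) = list_val j ts i).
Proof.
  revert k j s; induction ts as [| t ts IH]; intros k j s Hs; cbn zeta.
  - now split.
  - cbn [list_word]. rewrite pos_app, seq_acts_app.
    destruct (seq_acts_tree_word t k j s Hs) as (A1 & A2 & A3).
    destruct (IH _ _ _ A3) as (B1 & B2). split.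
    + intros i Hi. rewrite B1, A1 by lia. easy.
    + intros [| i].
      * rewrite Nat.add_0_r, B1 by lia. exact A2.
      * rewrite <- Nat.add_succ_comm. apply B2.
Qed.

Definition forest_nth (f : forest) (i : nat) : tree := nth i (fst f :: snd f) leaf.

(** Both words are applied to the sequence [S], whose labels are consecutive; the resulting entries
    are the values of the trees and determine them. Trailing leaves in the lists stay invisible. *)
Lemma forest_word_inj f g : Feq (pos (forest_word f)) (pos (forest_word g)) ->
  forall i, forest_nth f i = forest_nth g i.
Proof.
  destruct f as [t ts], g as [t' ts']. intro H. apply (list_val_inj _ _ 0).
  intro i.
  destruct (seq_acts_list_word (t :: ts) 0 0 S (fun _ => eq_refl)) as [_ E].
  destruct (seq_acts_list_word (t' :: ts') 0 0 S (fun _ => eq_refl)) as [_ E'].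
  cbn [fst snd]. rewrite <- E, <- E'. exact (seq_acts_Feq _ _ H S (0 + i)).
Qed.

(** Excludes trailing leaves, so that each finitely supported forest has exactly one list. *)
Fixpoint reduced (ts : list tree) : Prop :=
  match ts with
  | [] => True
  | t :: ts => reduced ts /\ (ts = [] -> t <> leaf)
  end.

Lemma reduced_leaves ts : reduced ts -> (forall i, nth i ts leaf = leaf) -> ts = [].
Proof.
  induction ts as [| t ts IH]; [easy |]. intros [Hr Hl] H. exfalso.
  apply (Hl (IH Hr (fun i => H (S i)))). exact (H 0).
Qed.

Lemma reduced_ext ts ts' : reduced ts -> reduced ts' ->
  (forall i, nth i ts leaf = nth i ts' leaf) -> ts = ts'.
Proof.
  revert ts'; induction ts as [| t ts IH]; intros ts' Hr Hr' H.
  - symmetry. apply reduced_leaves; [easy |]. intro i. rewrite <- H. now destruct i.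
  - destruct ts' as [| t' ts'].
    + apply reduced_leaves; [easy |]. intro i. rewrite H. now destruct i.
    + f_equal; [exact (H 0) |]. apply IH; [apply Hr | apply Hr' |].
      intro i. exact (H (S i)).
Qed.

Lemma reduced_forest_word_inj f g : reduced (snd f) -> reduced (snd g) ->
  Feq (pos (forest_word f)) (pos (forest_word g)) -> f = g.
Proof.
  destruct f as [t ts], g as [t' ts']. intros Hf Hg H.
  pose proof (forest_word_inj _ _ H) as E. f_equal; [exact (E 0) |].
  apply reduced_ext; [easy | easy |]. intro i. exact (E (S i)).
Qed.

Lemma reduced_tl ts : reduced ts -> reduced (tl ts).
Proof. destruct ts; [easy |]. now intros [H _]. Qed.

Lemma reduced_join n ts : reduced ts -> reduced (join n ts).
Proof.
  revert ts; induction n as [| n IH]; intros ts H; cbn; split.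
  - now apply reduced_tl, reduced_tl.
  - easy.
  - now apply IH, reduced_tl.
  - now destruct n.
Qed.

Lemma reduced_acts w : reduced (snd (acts w trivial_forest)).
Proof.
  induction w as [| [| n] w IH]; cbn; [easy | |].
  - now apply reduced_tl.
  - now apply reduced_join.
Qed.

(** * Word length of positive elements *)

(** The cost of a tree at position 1: one letter x_1 per caret, and a pointer move forth and back
    for each right subtree that is not a leaf. *)
Fixpoint tree_weight (t : tree) : nat :=
  match t with
  | leaf => 0
  | node a b =>
      S (tree_weight a + match b with leaf => 0 | _ => 2 + tree_weight b end)
  end.

Fixpoint list_weight (ts : list tree) : nat :=
  match ts with
  | [] => 0
  | t :: ts => tree_weight t + match ts with [] => 0 | _ => 2 + list_weight ts end
  end.

(* The carets on the left spine of the first tree are those of the generator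
   [x_0], which needs no return of the pointer. *)
Fixpoint spine_weight (t : tree) : nat :=
  match t with
  | leaf => 0
  | node a b => S (spine_weight a + tree_weight b)
  end.

Definition weight (f : forest) : nat := spine_weight (fst f) + list_weight (snd f).

Definition conj0 (w : word) : word := @cons letter (0, false) (w ++ [(0, true)]).

Lemma conj0_length w : length (conj0 w) = 2 + length w.
Proof. unfold conj0. cbn [length]. rewrite length_app. cbn. lia. Qed.

Lemma conj0_gen01 w : gen01_word w -> gen01_word (conj0 w).
Proof.
  intro H. constructor; [cbn; lia |].
  apply Forall_app; split; [easy |]. repeat constructor.
Qed.

Global Instance conj0_Feq : Proper (Feq ==> Feq) conj0.
Proof. intros w w' H. unfold conj0. now rewrite H. Qed.

(** Spells the tree at position 1. The right subtree belongs at position 2, which is reached by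
    conjugating its spelling at position 1 by x_0. *)
Fixpoint tree_geodesic (t : tree) : word :=
  match t with
  | leaf => []
  | node a b =>
      @cons letter (1, true)
        (match b with leaf => [] | _ => conj0 (tree_geodesic b) end
           ++ tree_geodesic a)
  end.

Fixpoint list_geodesic (ts : list tree) : word :=
  match ts with
  | [] => []
  | t :: ts =>
      match ts with [] => [] | _ => conj0 (list_geodesic ts) end ++ tree_geodesic t
  end.

Fixpoint spine_geodesic (t : tree) : word :=
  match t with
  | leaf => []
  | node a b => @cons letter (0, true) (tree_geodesic b ++ spine_geodesic a)
  end.

Definition forest_geodesic (f : forest) : word :=
  list_geodesic (snd f) ++ spine_geodesic (fst f).

Lemma tree_geodesic_length t : length (tree_geodesic t) = tree_weight t.
Proof.
  induction t as [| a IHa b IHb]; cbn [tree_geodesic tree_weight]; [easy |].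
  cbn [length]. rewrite length_app, IHa.
  destruct b; [cbn; lia |]. rewrite conj0_length, IHb. lia.
Qed.

Lemma list_geodesic_length ts : length (list_geodesic ts) = list_weight ts.
Proof.
  induction ts as [| t ts IH]; cbn [list_geodesic list_weight]; [easy |].
  rewrite length_app, tree_geodesic_length.
  destruct ts; [cbn; lia |]. rewrite conj0_length, IH. lia.
Qed.

Lemma forest_geodesic_length f : length (forest_geodesic f) = weight f.
Proof.
  destruct f as [t ts]. unfold forest_geodesic, weight; cbn [fst snd].
  rewrite length_app, list_geodesic_length.
  enough (length (spine_geodesic t) = spine_weight t) by lia.
  induction t as [| a IHa b _]; cbn; [easy |].
  rewrite length_app, tree_geodesic_length, IHa. lia.
Qed.

Lemma tree_geodesic_gen01 t : gen01_word (tree_geodesic t).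
Proof.
  unfold gen01_word.
  induction t as [| a IHa b IHb]; cbn [tree_geodesic]; [easy |].
  constructor; [easy |]. apply Forall_app; split; [| easy].
  destruct b; [easy |]. now apply conj0_gen01.
Qed.

Lemma forest_geodesic_gen01 f : gen01_word (forest_geodesic f).
Proof.
  destruct f as [t ts]. apply Forall_app; cbn [fst snd]; split.
  - induction ts as [| u ts IH]; cbn [list_geodesic]; [easy |].
    apply Forall_app; split; [| apply tree_geodesic_gen01].
    destruct ts; [easy |]. now apply conj0_gen01.
  - induction t as [| a IHa b _]; cbn; [easy |].
    constructor; [cbn; lia |].
    apply Forall_app; split; [apply tree_geodesic_gen01 | easy].
Qed.

Lemma tree_word_conj n t :
  Feq (pos (tree_word (S (S n)) t))
      (conj0 (pos (tree_word (S n) t))).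
Proof.
  rewrite (tree_word_S (S n)). apply Feq_shift_conj.
  eapply Forall_impl; [| apply tree_word_ge]. cbn; lia.
Qed.

Lemma list_word_conj n ts :
  Feq (pos (list_word (S (S n)) ts))
      (conj0 (pos (list_word (S n) ts))).
Proof.
  rewrite (list_word_S (S n)). apply Feq_shift_conj.
  eapply Forall_impl; [| apply list_word_ge]. cbn; lia.
Qed.

Lemma tree_geodesic_word t : Feq (tree_geodesic t) (pos (tree_word 1 t)).
Proof.
  induction t as [| a IHa b IHb]; cbn [tree_geodesic tree_word]; [reflexivity |].
  change (pos (1 :: ?w)) with ((1, true) :: pos w).
  rewrite pos_app, IHa. apply cons_Feq.
  destruct b; [reflexivity |].
  now rewrite IHb, tree_word_conj.
Qed.

Lemma forest_geodesic_word f : Feq (forest_geodesic f) (pos (forest_word f)).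
Proof.
  destruct f as [t ts]. unfold forest_geodesic, forest_word; cbn [fst snd].
  rewrite pos_app. apply app_Feq.
  - induction ts as [| u ts IH]; cbn [list_geodesic list_word]; [reflexivity |].
    rewrite pos_app, tree_geodesic_word.
    destruct ts; [reflexivity |]. now rewrite IH, list_word_conj.
  - induction t as [| a IHa b _]; cbn [spine_geodesic tree_word]; [reflexivity |].
    change (pos (0 :: ?w)) with ((0, true) :: pos w).
    now rewrite pos_app, IHa, tree_geodesic_word.
Qed.

(** * Growth of forests at their leaves and monotonicity of the weight *)

Inductive tree_le : tree -> tree -> Prop :=
| leaf_le t : tree_le leaf t
| node_le a b a' b' : tree_le a a' -> tree_le b b' -> tree_le (node a b) (node a' b').

Lemma act_forest_nth n f i : i <= n ->
  forest_nth (act n f) i =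
  if i =? n then node (forest_nth f n) (forest_nth f (S n)) else forest_nth f i.
Proof.
  destruct f as [t ts]. intro H. unfold forest_nth.
  destruct n as [| n]; cbn [act fst snd].
  - replace i with 0 by lia. now destruct ts.
  - destruct i as [| i]; [easy |]. cbn [nth Nat.eqb]. apply le_S_n in H.
    revert ts i H; induction n as [| n IH]; intros ts i H.
    + replace i with 0 by lia. now destruct ts as [| ? [| ? ?]].
    + destruct i as [| i]; [now destruct ts |].
      cbn [join nth Nat.eqb]. rewrite IH by lia. destruct ts; [| easy].
      now destruct i, n.
Qed.

Lemma acts_tree_word t n f :
  let g := acts (tree_word n t) f in
  (forall i, i < n -> forest_nth g i = forest_nth f i) /\
  tree_le t (forest_nth g n).
Proof.
  revert n f; induction t as [| a IHa b IHb]; intros n f; cbn zeta.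
  - split; [easy | constructor].
  - cbn [tree_word acts fold_right]. fold (acts (tree_word (S n) b ++ tree_word n a) f).
    rewrite acts_app.
    destruct (IHa n f) as [A1 A2].
    destruct (IHb (S n) (acts (tree_word n a) f)) as [B1 B2].
    split.
    + intros i Hi. rewrite act_forest_nth by lia. nat_cases.
      rewrite B1, A1 by lia. easy.
    + rewrite act_forest_nth, Nat.eqb_refl by lia.
      constructor; [| easy]. now rewrite B1 by lia.
Qed.

Lemma acts_list_word ts n f :
  let g := acts (list_word n ts) f in
  (forall i, i < n -> forest_nth g i = forest_nth f i) /\
  (forall i, tree_le (nth i ts leaf) (forest_nth g (n + i))).
Proof.
  revert n f; induction ts as [| t ts IH]; intros n f; cbn zeta.
  - split; [easy |]. intros [| i]; constructor.
  - cbn [list_word]. rewrite acts_app.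
    destruct (acts_tree_word t n f) as [A1 A2].
    destruct (IH (S n) (acts (tree_word n t) f)) as [B1 B2].
    split.
    + intros i Hi. rewrite B1, A1 by lia. easy.
    + intros [| i].
      * cbn [nth]. now rewrite B1, Nat.add_0_r by lia.
      * rewrite <- Nat.add_succ_comm. apply B2.
Qed.

(** The word of [f] puts the same carets on top of the trees of [g] as it puts on leaves. Hence
    right multiplication by a positive element only grows a forest downwards. *)
Lemma acts_forest_word_le f g i :
  tree_le (forest_nth f i) (forest_nth (acts (forest_word f) g) i).
Proof.
  destruct f as [t ts]. exact (proj2 (acts_list_word (t :: ts) 0 g) i).
Qed.

Fixpoint carets (t : tree) : nat :=
  match t with leaf => 0 | node a b => S (carets a + carets b) end.

Fixpoint list_carets (ts : list tree) : nat :=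
  match ts with [] => 0 | t :: ts => carets t + list_carets ts end.

Lemma list_carets_ext ts ts' : (forall i, nth i ts leaf = nth i ts' leaf) ->
  list_carets ts = list_carets ts'.
Proof.
  revert ts'; induction ts as [| t ts IH].
  - induction ts' as [| t' ts' IH']; intro H; [easy |].
    assert (t' = leaf) as -> by (symmetry; exact (H 0)). apply IH'.
    intro i. transitivity leaf; [now destruct i | exact (H (S i))].
  - intros [| t' ts'] H.
    + assert (t = leaf) as -> by exact (H 0). apply (IH []).
      intro i. transitivity leaf; [exact (H (S i)) | now destruct i].
    + assert (t = t') as -> by exact (H 0). cbn.
      now rewrite (IH ts' (fun i => H (S i))).
Qed.

Definition forest_carets (f : forest) : nat := carets (fst f) + list_carets (snd f).

Lemma tree_word_length n t : length (tree_word n t) = carets t.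
Proof.
  revert n; induction t as [| a IHa b IHb]; intro n; cbn; [easy |].
  rewrite length_app, IHa, IHb. lia.
Qed.

Lemma forest_word_length f : length (forest_word f) = forest_carets f.
Proof.
  destruct f as [t ts]. unfold forest_word, forest_carets; cbn [fst snd].
  rewrite length_app, tree_word_length.
  enough (forall n, length (list_word n ts) = list_carets ts) as -> by lia.
  induction ts as [| u ts IH]; intro n; cbn; [easy |].
  rewrite length_app, tree_word_length, IH. lia.
Qed.

Lemma join_carets n ts : list_carets (join n ts) = S (list_carets ts).
Proof.
  revert ts; induction n as [| n IH]; intros ts; cbn [join list_carets].
  - destruct ts as [| ? [| ? ?]]; cbn; lia.
  - rewrite IH. destruct ts; cbn; lia.
Qed.

Lemma acts_carets w f : forest_carets (acts w f) = length w + forest_carets f.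
Proof.
  induction w as [| n w IH]; [easy |]. cbn [acts fold_right length].
  fold (acts w f). rewrite Nat.add_succ_l, <- IH.
  destruct (acts w f) as [t ts]. unfold forest_carets.
  destruct n as [| n]; cbn [act fst snd].
  - destruct ts; cbn; lia.
  - rewrite join_carets. lia.
Qed.

(** The weight exceeds the number of carets by twice the number of carets whose right child is not a
    leaf, and growth never lowers that number. *)
Lemma tree_weight_mono t t' : tree_le t t' ->
  tree_weight t + carets t' <= tree_weight t' + carets t.
Proof.
  assert (Hw : forall t, carets t <= tree_weight t).
  { induction t0 as [| a IHa b IHb]; cbn; [easy |]. destruct b; cbn in *; lia. }
  induction 1 as [t | a b a' b' _ IHa Hb IHb]; [specialize (Hw t); cbn; lia |].
  cbn [tree_weight carets].
  destruct b as [| b1 b2].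
  - specialize (Hw b'). destruct b'; cbn [carets] in *; lia.
  - inversion Hb; subst. lia.
Qed.

Lemma spine_weight_mono t t' : tree_le t t' ->
  spine_weight t + carets t' <= spine_weight t' + carets t.
Proof.
  induction 1 as [t | a b a' b' _ IHa Hb _]; cbn [spine_weight carets].
  - enough (carets t <= spine_weight t) by (cbn; lia).
    induction t as [| a IHa b _]; cbn; [easy |].
    pose proof (tree_weight_mono _ _ (leaf_le b)). cbn in *; lia.
  - apply tree_weight_mono in Hb. lia.
Qed.

Lemma list_weight_mono ts ts' : reduced ts ->
  (forall i, tree_le (nth i ts leaf) (nth i ts' leaf)) ->
  list_weight ts + list_carets ts' <= list_weight ts' + list_carets ts.
Proof.
  revert ts'; induction ts as [| t ts IH]; intros ts' Hr H.
  - cbn. rewrite Nat.add_0_r. induction ts' as [| t' ts' IH']; cbn; [easy |].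
    pose proof (tree_weight_mono _ _ (leaf_le t')). cbn in *.
    assert (list_carets ts' <= list_weight ts').
    { apply IH'. intros [|]; constructor. }
    destruct ts'; cbn in *; lia.
  - destruct ts' as [| t' ts'].
    (* A nonempty reduced list contains a tree with a caret, which cannot lie below a leaf; so the
       larger forest has at least as many listed trees. *)
    { exfalso. enough (t :: ts = []) by easy. apply reduced_leaves; [easy |].
      intro i. specialize (H i). inversion H; [easy |]. now destruct i. }
    pose proof (tree_weight_mono _ _ (H 0)) as Ht. cbn [nth] in Ht.
    specialize (IH ts' (proj1 Hr) (fun i => H (S i))).
    cbn [list_weight list_carets].
    destruct ts as [| u ts], ts' as [| u' ts']; cbn [list_weight list_carets] in *;
      try lia.
    exfalso. enough (u :: ts = []) by easy. apply reduced_leaves; [apply Hr |].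
    intro i. specialize (H (S i)). cbn in H. inversion H; [easy |]. now destruct i.
Qed.

Lemma weight_mono f g : reduced (snd f) ->
  (forall i, tree_le (forest_nth f i) (forest_nth g i)) ->
  weight f + forest_carets g <= weight g + forest_carets f.
Proof.
  destruct f as [t ts], g as [t' ts']. unfold weight, forest_carets; cbn [fst snd].
  intros Hr H. pose proof (spine_weight_mono _ _ (H 0)).
  pose proof (list_weight_mono ts ts' Hr (fun i => H (S i))). cbn in *. lia.
Qed.

(** * The lower bound for the word length *)

Lemma weight_act n f : n <= 1 -> weight (act n f) <= S (weight f).
Proof.
  intro H. destruct f as [t ts]. unfold weight.
  destruct n as [| [| n]]; [| | lia]; cbn [act fst snd].
  - destruct ts as [| a [| b ts]]; cbn; lia.
  (* The two moves that led to [b] in the list now lead to it as a right subtree, so only the new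
     caret is charged. *)
  - destruct ts as [| a [| b [| c ts]]]; cbn [join hd tl list_weight tree_weight];
      try (destruct b; cbn [tree_weight]); lia.
Qed.

(** The letter x_j passes to the right through smaller indices and its own index only grows; it
    stays large enough for each recursive call. *)
Lemma tree_word_commute t n j : n < j ->
  exists k, j <= k /\ Feq (pos (tree_word n t ++ [k])) (pos (j :: tree_word n t)).
Proof.
  revert n j; induction t as [| a IHa b IHb]; intros n j H.
  - exists j. now split.
  - destruct (IHb (S n) (S j)) as (k & Hk & Eb); [lia |].
    destruct (IHa n k) as (l & Hl & Ea); [lia |].
    exists l. split; [lia |]. cbn [tree_word].
    cbn [app]. rewrite <- app_assoc.
    change (pos (?i :: ?w)) with ((i, true) :: pos w).
    change (Feq ((n, true) :: pos (tree_word (S n) b ++ tree_word n a ++ [l]))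
      ((j, true) :: (n, true) :: pos (tree_word (S n) b ++ tree_word n a))).
    rewrite Feq_swap by easy. apply cons_Feq.
    rewrite pos_app, Ea. change (k :: ?w) with ([k] ++ w).
    rewrite <- pos_app, app_assoc, pos_app, Eb, <- pos_app. reflexivity.
Qed.

(** If tree number [s] is a node, its root caret is removed and [u] is empty. If it is a leaf, the
    one letter [u] first grafts a caret there. Splitting adds at most one move forth and back to the
    weight. *)
Lemma forest_complement s f : s <= 1 ->
  exists u g, Feq (pos (forest_word f ++ u)) (pos (s :: forest_word g)) /\
    weight g <= weight f + length u + 1.
Proof.
  intro Hs. destruct f as [t ts]. destruct s as [| [| s]]; [| | lia].
  - destruct t as [| a b].
    + exists [0], (leaf, leaf :: ts). split.
      * unfold forest_word; cbn [fst snd tree_word list_word].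
        rewrite !app_nil_r. symmetry. apply list_word_shift. lia.
      * unfold weight; cbn. destruct ts; cbn; lia.
    + exists [], (a, b :: ts). split.
      * rewrite app_nil_r, forest_word_act. reflexivity.
      * unfold weight; cbn. destruct ts; cbn; lia.
  (* Tree number 1 can be a leaf in two ways: listed, or implicit because the list is empty. *)
  - assert (E : (exists a b ts', ts = node a b :: ts') \/
                exists ts', (forall n, list_word n ts = list_word (S n) ts') /\
                  (ts = [] /\ ts' = [] \/ ts = leaf :: ts')).
    { destruct ts as [| [| a b] ts'].
      - right. exists []. split; auto.
      - right. exists ts'. split; auto. intro n. cbn. now rewrite app_nil_r.
      - left. now exists a, b, ts'. }
    destruct E as [(a & b & ts' & ->) | (ts' & E & C)].
    + exists [], (t, a :: b :: ts'). split.
      * rewrite app_nil_r, forest_word_act. reflexivity.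
      * unfold weight; cbn [fst snd list_weight tree_weight].
        destruct b; destruct ts'; cbn [tree_weight length]; lia.
    (* The letter x_k splits the leaf that is tree number 1; its index also counts the leaves of [t]
       before it. *)
    + destruct (tree_word_commute t 0 1) as (k & _ & Hk); [lia |].
      exists [k], (t, leaf :: leaf :: ts'). split.
      * unfold forest_word; cbn [fst snd list_word tree_word].
        rewrite E, !app_nil_r, <- app_assoc, pos_app, Hk, <- pos_app.
        change (1 :: tree_word 0 t) with ([1] ++ tree_word 0 t).
        rewrite app_assoc, pos_app, app_comm_cons, pos_app.
        rewrite <- (pos_app _ [1]), <- list_word_shift by lia. now rewrite <- pos_app.
      * unfold weight; cbn [fst snd length].
        destruct C as [[-> ->] | ->]; [cbn; lia |].
        destruct ts'; cbn [list_weight tree_weight]; lia.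
Qed.

Lemma weight_le_length v p q : gen01_word v -> reduced (snd p) ->
  Feq (v ++ pos (forest_word q)) (pos (forest_word p)) ->
  weight p <= weight q + length v.
Proof.
  revert p q; induction v as [| [s e] v IH] using rev_ind; intros p q Hv Hp H.
  - cbn in *. pose proof (forest_word_inj _ _ H) as E. rewrite Nat.add_0_r.
    (* The list of [q] may end in leaves that add to its weight, so equal trees give only an
       inequality. *)
    enough (weight p + forest_carets q <= weight q + forest_carets p).
    { assert (forest_carets p = forest_carets q); [| lia].
      destruct p as [t ts], q as [t' ts']. symmetry. exact (list_carets_ext (t' :: ts') (t :: ts) E). }
    apply weight_mono; [easy |]. intro i. rewrite E.
    induction (forest_nth p i); now constructor.
  - apply Forall_app in Hv as [Hv Hs]. inversion Hs as [| ? ? Hs1 _]; subst.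
    cbn in Hs1. rewrite <- app_assoc in H. rewrite length_app. cbn [length app] in *.
    destruct e.
    + change ((s, true) :: pos (forest_word q)) with (pos (s :: forest_word q)) in H.
      rewrite forest_word_act in H. apply IH in H; [| easy | easy].
      pose proof (weight_act s q Hs1). lia.
    + destruct (forest_complement s q Hs1) as (u & g & E & Hg).
      (* From [v s^{-1} q = p] and [q u = s g] follows [v g = p u], and [p'] is the forest of [p u].
         The [length u] lost in passing from [q] to [g] is regained from [p] to [p']. *)
      set (p' := acts (forest_word p ++ u) trivial_forest).
      assert (Hp' : weight p' <= weight g + length v).
      { apply IH; [easy | apply reduced_acts |]. subst p'.
        rewrite <- forest_word_acts, pos_app, <- H, <- app_assoc.
        cbn [app]. rewrite <- pos_app, E. apply app_Feq; [reflexivity |].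
        symmetry. exact (Feq_cancel (s, false) _). }
      assert (M : weight p + forest_carets p' <= weight p' + forest_carets p).
      { apply weight_mono; [easy |]. intro i. subst p'. rewrite acts_app.
        apply acts_forest_word_le. }
      assert (C : forest_carets p' = forest_carets p + length u).
      { subst p'. rewrite acts_carets, length_app, forest_word_length. cbn. lia. }
      lia.
Qed.

Lemma word_length_forest w f n : reduced (snd f) -> Feq w (pos (forest_word f)) ->
  (word_length w n <-> n = weight f).
Proof.
  intros Hf Hw. split.
  - intros [(v & Hv & <- & Ev) Hmin].
    assert (E : Feq (v ++ pos (forest_word trivial_forest)) (pos (forest_word f))).
    { rewrite app_nil_r. now rewrite Ev. }
    pose proof (weight_le_length v f trivial_forest Hv Hf E) as Hle. cbn in Hle.
    specialize (Hmin _ (forest_geodesic_gen01 f)).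
    rewrite forest_geodesic_length in Hmin.
    enough (length v <= weight f) by lia. apply Hmin.
    now rewrite forest_geodesic_word.
  - intros ->. split.
    + exists (forest_geodesic f).
      split; [apply forest_geodesic_gen01 |].
      split; [apply forest_geodesic_length |].
      now rewrite forest_geodesic_word.
    + intros v Hv Ev.
      assert (E : Feq (v ++ pos (forest_word trivial_forest)) (pos (forest_word f))).
      { rewrite app_nil_r. now rewrite Ev. }
      exact (weight_le_length v f trivial_forest Hv Hf E).
Qed.

Lemma positive_forest w : positive_elt w <->
  exists f, reduced (snd f) /\ Feq w (pos (forest_word f)).
Proof.
  split.
  - intros (v & Hv & E). assert (exists q, v = pos q) as [q ->].
    { exists (map fst v). unfold pos. rewrite map_map. clear E.
      induction Hv as [| [n e] v He _ IH]; cbn in *; [easy |]. subst.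
      now rewrite <- IH. }
    exists (acts q trivial_forest). split; [apply reduced_acts |].
    now rewrite <- E, <- forest_word_acts.
  - intros (f & _ & E). exists (pos (forest_word f)). split; [| now symmetry].
    unfold pos. apply Forall_map, Forall_forall. easy.
Qed.

(** * Counting forests by weight *)

(** Hangs a caret with right subtree [b] on the leftmost leaf. Every tree other than [leaf] arises
    so in one way, which lets left spines be read from the bottom. *)
Fixpoint graft (b t : tree) : tree :=
  match t with
  | leaf => node leaf b
  | node u v => node (graft b u) v
  end.

Fixpoint ungraft (t : tree) : option (tree * tree) :=
  match t with
  | leaf => None
  | node u v =>
      match ungraft u with
      | None => Some (v, leaf)
      | Some (b, u') => Some (b, node u' v)
      end
  end.

Lemma ungraft_graft b t : ungraft (graft b t) = Some (b, t).
Proof. induction t as [| u IH v _]; cbn; [easy |]. now rewrite IH. Qed.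

Lemma graft_inj b t b' t' : graft b t = graft b' t' -> b = b' /\ t = t'.
Proof.
  intro H. apply (f_equal ungraft) in H. rewrite !ungraft_graft in H.
  now injection H.
Qed.

Lemma graft_not_leaf b t : graft b t <> leaf.
Proof. now destruct t. Qed.

Lemma graft_view t : t = leaf \/ exists b t', t = graft b t'.
Proof.
  induction t as [| u [-> | (b & u' & ->)] v _]; [now left | |]; right.
  - now exists v, leaf.
  - now exists b, (node u' v).
Qed.

Lemma tree_weight_graft b t :
  tree_weight (graft b t)
  = S (tree_weight t + match b with leaf => 0 | _ => 2 + tree_weight b end).
Proof.
  induction t as [| u IH v _]; cbn [graft tree_weight]; [easy |]. lia.
Qed.

Lemma spine_weight_graft b t :
  spine_weight (graft b t) = S (spine_weight t + tree_weight b).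
Proof. induction t as [| u IH v _]; cbn; lia. Qed.

(* [graft_snd leaf] is right multiplication by [x_1]; [mul0] by [x_0]. *)
Definition graft_snd (b : tree) (f : forest) : forest :=
  match ungraft (fst f) with
  | Some (c, t) => (graft (graft b c) t, snd f)
  | None => (leaf, match snd f with
                   | [] => [graft b leaf]
                   | t :: ts => graft b t :: ts
                   end)
  end.

Definition mul0 (f : forest) : forest := (graft leaf (fst f), snd f).

(** The bijection of weight 2: the lowest spine caret, with its right subtree [b], moves from the
    first leaf of the forest to the second, where [b] costs a move forth and back. Without such a
    caret the whole list moves one place on. *)
Definition descend (f : forest) : forest :=
  match ungraft (fst f) with
  | Some (b, t) => graft_snd b (t, snd f)
  | None => (leaf, leaf :: snd f)
  end.

(* The nontrivial forests that are not of the form [mul0 f]. *)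
Definition indivisible0 (f : forest) : Prop :=
  match ungraft (fst f) with
  | Some (b, _) => b <> leaf
  | None => snd f <> []
  end.

Lemma graft_snd_leaf b ts :
  graft_snd b (leaf, ts) = (leaf, graft b (hd leaf ts) :: tl ts).
Proof. now destruct ts. Qed.

Lemma graft_snd_graft b c t ts :
  graft_snd b (graft c t, ts) = (graft (graft b c) t, ts).
Proof. unfold graft_snd; cbn [fst snd]. now rewrite ungraft_graft. Qed.

Lemma descend_graft b t ts : descend (graft b t, ts) = graft_snd b (t, ts).
Proof. unfold descend; cbn [fst snd]. now rewrite ungraft_graft. Qed.

Lemma indivisible0_graft b t ts : indivisible0 (graft b t, ts) <-> b <> leaf.
Proof. unfold indivisible0; cbn [fst snd]. now rewrite ungraft_graft. Qed.

Lemma weight_mul0 f : weight (mul0 f) = S (weight f).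
Proof. unfold weight, mul0; cbn [fst snd]. rewrite spine_weight_graft. cbn. lia. Qed.

Lemma weight_graft_snd b f :
  weight (graft_snd b f)
  = S (weight f + match b with leaf => 0 | _ => 2 + tree_weight b end).
Proof.
  destruct f as [t ts]. unfold weight.
  destruct (graft_view t) as [-> | (c & t' & ->)].
  - rewrite graft_snd_leaf; cbn [fst snd].
    destruct ts; cbn [hd tl list_weight spine_weight]; rewrite tree_weight_graft;
      cbn [tree_weight]; lia.
  - rewrite graft_snd_graft; cbn [fst snd].
    rewrite !spine_weight_graft, tree_weight_graft. lia.
Qed.

Lemma weight_descend f : indivisible0 f -> weight (descend f) = S (S (weight f)).
Proof.
  destruct f as [t ts]. destruct (graft_view t) as [-> | (c & t' & ->)].
  - unfold weight; cbn. now destruct ts.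
  - rewrite indivisible0_graft, descend_graft, weight_graft_snd. intro H.
    unfold weight; cbn [fst snd]. rewrite spine_weight_graft.
    destruct c; [easy |]. lia.
Qed.

Lemma reduced_graft_snd b f : reduced (snd f) -> reduced (snd (graft_snd b f)).
Proof.
  destruct f as [t ts]. destruct (graft_view t) as [-> | (c & t' & ->)].
  - rewrite graft_snd_leaf. cbn [snd]. intro H. split; [now apply reduced_tl |].
    intros _. apply graft_not_leaf.
  - now rewrite graft_snd_graft.
Qed.

Lemma reduced_descend f : indivisible0 f -> reduced (snd f) -> reduced (snd (descend f)).
Proof.
  destruct f as [t ts]. destruct (graft_view t) as [-> | (c & t' & ->)].
  - now split.
  - rewrite descend_graft. intros _ H. now apply reduced_graft_snd.
Qed.

Lemma indivisible0_graft_snd b f : indivisible0 (graft_snd b f).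
Proof.
  destruct f as [t ts]. destruct (graft_view t) as [-> | (c & t' & ->)].
  - now rewrite graft_snd_leaf.
  - rewrite graft_snd_graft. apply indivisible0_graft, graft_not_leaf.
Qed.

Lemma indivisible0_descend f : indivisible0 (descend f).
Proof.
  destruct f as [t ts]. destruct (graft_view t) as [-> | (c & t' & ->)].
  - easy.
  - rewrite descend_graft. apply indivisible0_graft_snd.
Qed.

Lemma not_indivisible0_mul0 f : ~ indivisible0 (mul0 f).
Proof. unfold mul0. now rewrite indivisible0_graft. Qed.

Lemma mul0_inj f g : mul0 f = mul0 g -> f = g.
Proof.
  destruct f, g. unfold mul0; cbn. intro H. injection H as H ->.
  now apply graft_inj in H as [_ ->].
Qed.

Lemma reduced_hd_tl ts ts' : reduced ts -> reduced ts' ->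
  hd leaf ts = hd leaf ts' -> tl ts = tl ts' -> ts = ts'.
Proof.
  intros H H' Eh Et. apply reduced_ext; [easy | easy |].
  destruct ts, ts'; cbn in *; subst; try easy; now intros [| [|]].
Qed.

(** The caret at the second leaf can be taken off again. Reducedness tells the empty list from a
    single listed leaf, on which [graft_snd] agrees. *)
Lemma graft_snd_inj b f c g : reduced (snd f) -> reduced (snd g) ->
  graft_snd b f = graft_snd c g -> b = c /\ f = g.
Proof.
  destruct f as [t ts], g as [t' ts']; cbn [snd]. intros Hf Hg.
  destruct (graft_view t) as [-> | (d & u & ->)], (graft_view t') as [-> | (d' & u' & ->)];
    rewrite ?graft_snd_leaf, ?graft_snd_graft; intro E; injection E.
  - intros Et Eh. apply graft_inj in Eh as [-> Eh].
    split; [easy |]. f_equal. now apply reduced_hd_tl.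
  - intros _ Ed. now apply eq_sym, graft_not_leaf in Ed.
  - intros _ Ed. now apply graft_not_leaf in Ed.
  - intros -> Ed. apply graft_inj in Ed as [Ed ->].
    now apply graft_inj in Ed as [-> ->].
Qed.

Lemma descend_inj f g : reduced (snd f) -> reduced (snd g) ->
  descend f = descend g -> f = g.
Proof.
  destruct f as [t ts], g as [t' ts']; cbn [snd]. intros Hf Hg.
  (* The two branches of [descend] have disjoint images: [graft_snd] always leaves a caret at the
     second leaf. *)
  assert (N : forall b u us vs, graft_snd b (u, us) <> (leaf, leaf :: vs)).
  { intros b u us vs. destruct (graft_view u) as [-> | (d & u' & ->)];
      rewrite ?graft_snd_leaf, ?graft_snd_graft; intro E; injection E.
    - intros _ Eh. now apply graft_not_leaf in Eh.
    - intros _ Eh. now apply graft_not_leaf in Eh. }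
  destruct (graft_view t) as [-> | (d & u & ->)], (graft_view t') as [-> | (d' & u' & ->)];
    rewrite ?descend_graft; intro E.
  - now injection E as ->.
  - now apply eq_sym, N in E.
  - now apply N in E.
  - apply graft_snd_inj in E as [-> E]; [| easy | easy]. now injection E as -> ->.
Qed.

(** The second leaf decides: on the left it hangs on a caret with right child [leaf], on the right
    it is a whole tree or hangs on a caret whose right child is a node. *)
Lemma graft_snd_leaf_descend f g : reduced (snd f) -> reduced (snd g) ->
  indivisible0 g -> graft_snd leaf f <> descend g.
Proof.
  destruct g as [t ts]. intros Hf Hg Hi E.
  destruct (graft_view t) as [-> | (b & u & ->)].
  - destruct f as [t' ts']. cbn in E.
    destruct (graft_view t') as [-> | (d & u' & ->)];
      rewrite ?graft_snd_leaf, ?graft_snd_graft in E; injection E.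
    + intros _ Eh. now apply graft_not_leaf in Eh.
    + intros _ Eh. now apply graft_not_leaf in Eh.
  - rewrite descend_graft in E. apply graft_snd_inj in E as [<- _]; [| easy | easy].
    now apply indivisible0_graft in Hi.
Qed.

Lemma forest_cases f :
  f = trivial_forest \/ (exists g, f = mul0 g /\ snd g = snd f) \/ indivisible0 f.
Proof.
  destruct f as [t ts]. destruct (graft_view t) as [-> | (b & u & ->)].
  - destruct ts; [now left | now right; right].
  - right. destruct b as [| b1 b2].
    + left. now exists (u, ts).
    + right. now apply indivisible0_graft.
Qed.

(** The second leaf is either the whole tree number 1, or the left child of a caret with some right
    subtree [b]. [K] settles the latter case according to whether [b] is a leaf. *)
Lemma indivisible0_cases f : reduced (snd f) -> indivisible0 f ->
  (exists g, f = graft_snd leaf g /\ reduced (snd g)) \/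
  (exists g, f = descend g /\ reduced (snd g) /\ indivisible0 g).
Proof.
  assert (K : forall b g, reduced (snd g) -> f = graft_snd b g ->
    (exists g, f = graft_snd leaf g /\ reduced (snd g)) \/
    (exists g, f = descend g /\ reduced (snd g) /\ indivisible0 g)).
  { intros b [t ts] Hg ->. destruct b as [| b1 b2].
    - left. now exists (t, ts).
    - right. exists (graft (node b1 b2) t, ts).
      rewrite descend_graft, indivisible0_graft. now repeat split. }
  destruct f as [t ts]. intros Hf Hi.
  destruct (graft_view t) as [-> | (b & u & ->)].
  - destruct ts as [| t ts]; [easy |].
    destruct (graft_view t) as [-> | (b & u & ->)].
    + right. exists (leaf, ts). repeat split; [apply Hf |].
      intro E. now apply (proj2 Hf E).
    (* When taking off the caret leaves a bare leaf at the end of the list, the empty list must be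
       chosen to stay reduced. *)
    + destruct ts as [| t' ts], u as [| u1 u2].
      * now apply (K b (leaf, [])).
      * now apply (K b (leaf, [node u1 u2])).
      * apply (K b (leaf, leaf :: t' :: ts)); [| easy].
        split; [apply Hf | easy].
      * apply (K b (leaf, node u1 u2 :: t' :: ts)); [| easy].
        split; [apply Hf | easy].
  - apply indivisible0_graft in Hi.
    destruct (graft_view b) as [-> | (c & d & ->)]; [easy |].
    apply (K c (graft d u, ts)); [easy |]. now rewrite graft_snd_graft.
Qed.

(* The forests of weight [n], the [indivisible0] ones among them, and (for
   the two-step recursion) the [indivisible0] ones of weight [n - 1]. *)
Fixpoint enum (n : nat) : list forest * list forest * list forest :=
  match n with
  | 0 => ([trivial_forest], [], [])
  | S n =>
      let '(P, Q, Q') := enum n in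
      let Q1 := map (graft_snd leaf) P ++ map descend Q' in
      (map mul0 P ++ Q1, Q1, Q)
  end.

Definition all_forests (n : nat) : list forest := fst (fst (enum n)).
Definition indiv_forests (n : nat) : list forest := snd (fst (enum n)).
Definition indiv_forests_pred (n : nat) : list forest := snd (enum n).

Lemma all_forests_S n :
  all_forests (S n) = map mul0 (all_forests n) ++ indiv_forests (S n).
Proof.
  unfold all_forests, indiv_forests. cbn. now destruct (enum n) as [[P Q] Q'].
Qed.

Lemma indiv_forests_S n :
  indiv_forests (S n)
  = map (graft_snd leaf) (all_forests n) ++ map descend (indiv_forests_pred n).
Proof.
  unfold all_forests, indiv_forests, indiv_forests_pred.
  cbn. now destruct (enum n) as [[P Q] Q'].
Qed.

Lemma indiv_forests_pred_S n : indiv_forests_pred (S n) = indiv_forests n.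
Proof.
  unfold indiv_forests, indiv_forests_pred. cbn.
  now destruct (enum n) as [[P Q] Q'].
Qed.

Lemma weight_0 f : reduced (snd f) -> weight f = 0 -> f = trivial_forest.
Proof.
  intros Hf H0. destruct (forest_cases f) as [-> | [(g & -> & _) | Hi]]; [easy | |].
  - now rewrite weight_mul0 in H0.
  - destruct (indivisible0_cases f Hf Hi) as [(g & -> & _) | (g & -> & _ & Hg)].
    + now rewrite weight_graft_snd in H0.
    + now rewrite weight_descend in H0.
Qed.

Lemma in_enum n :
  (forall f, In f (all_forests n) <-> reduced (snd f) /\ weight f = n) /\
  (forall f, In f (indiv_forests n) <->
     reduced (snd f) /\ indivisible0 f /\ weight f = n) /\
  (forall f, In f (indiv_forests_pred n) <->
     reduced (snd f) /\ indivisible0 f /\ S (weight f) = n).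
Proof.
  induction n as [| n (IHP & IHQ & IHR)].
  - split; [| split]; intro f; split; cbn; try easy.
    + now intros [<- | []].
    + intros [H H0]. left. symmetry. now apply weight_0.
    + intros (H & Hi & H0). apply weight_0 in H0; [| easy]. subst. now apply Hi.
  - assert (Q : forall f, In f (indiv_forests (S n)) <->
      reduced (snd f) /\ indivisible0 f /\ weight f = S n).
    { intro f. rewrite indiv_forests_S, in_app_iff, !in_map_iff. split.
      - intros [(g & <- & Hg) | (g & <- & Hg)].
        + apply IHP in Hg as [Hg <-]. rewrite weight_graft_snd.
          split; [now apply reduced_graft_snd |].
          split; [apply indivisible0_graft_snd | lia].
        + apply IHR in Hg as (Hg & Hi & <-).
          split; [now apply reduced_descend |].
          split; [apply indivisible0_descend | now apply weight_descend].
      - intros (Hf & Hi & Hw).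
        destruct (indivisible0_cases f Hf Hi) as [(g & -> & Hg) | (g & -> & Hg & Hj)].
        + left. exists g. split; [easy |]. apply IHP.
          rewrite weight_graft_snd in Hw. split; [easy | lia].
        + right. exists g. split; [easy |]. apply IHR.
          rewrite weight_descend in Hw by easy. repeat split; [easy | easy | lia]. }
    split; [| split; [exact Q |]].
    + intro f. rewrite all_forests_S, in_app_iff, in_map_iff, Q. split.
      * intros [(g & <- & Hg) | (Hf & _ & Hw)]; [| easy].
        apply IHP in Hg as [Hg <-]. now rewrite weight_mul0.
      * intros [Hf Hw]. destruct (forest_cases f) as [-> | [(g & -> & Eg) | Hi]].
        -- easy.
        -- left. exists g. split; [easy |]. apply IHP.
           rewrite weight_mul0 in Hw. rewrite Eg. split; [easy | lia].
        -- now right.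
    + intro f. rewrite indiv_forests_pred_S, IHQ. intuition lia.
Qed.

Lemma NoDup_map_on {A B} (h : A -> B) (l : list A) :
  (forall x y, In x l -> In y l -> h x = h y -> x = y) -> NoDup l -> NoDup (map h l).
Proof.
  intros Hh. induction 1 as [| x l Hx _ IH]; cbn; constructor.
  - intro Hin. apply in_map_iff in Hin as (y & E & Hy).
    apply Hx. now rewrite <- (Hh y x (or_intror Hy) (or_introl eq_refl) E).
  - apply IH. intros y z Hy Hz. apply Hh; now right.
Qed.

Lemma NoDup_enum n :
  NoDup (all_forests n) /\ NoDup (indiv_forests n) /\ NoDup (indiv_forests_pred n).
Proof.
  induction n as [| n (IHP & IHQ & IHR)].
  - repeat constructor. easy.
  - destruct (in_enum n) as (EP & EQ & ER).
    assert (Q : NoDup (indiv_forests (S n))).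
    { rewrite indiv_forests_S. apply NoDup_app.
      - apply NoDup_map_on; [| easy]. intros f g Hf Hg E.
        apply EP in Hf, Hg. now apply graft_snd_inj in E.
      - apply NoDup_map_on; [| easy]. intros f g Hf Hg.
        apply ER in Hf, Hg. now apply descend_inj.
      - intros f H1 H2. apply in_map_iff in H1 as (g & <- & Hg), H2 as (h & E & Hh).
        apply EP in Hg. apply ER in Hh.
        symmetry in E. now apply graft_snd_leaf_descend in E. }
    split; [| split; [exact Q |]].
    + rewrite all_forests_S. apply NoDup_app; [| easy |].
      * apply NoDup_map_on; [| easy]. intros f g _ _. apply mul0_inj.
      * intros f H1 H2. apply in_map_iff in H1 as (g & <- & _).
        apply (proj1 (proj2 (in_enum (S n)))) in H2.
        now apply (not_indivisible0_mul0 g).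
    + now rewrite indiv_forests_pred_S.
Qed.

(** * The recurrence, the count of group elements and the power series *)

Definition num_forests (n : nat) : nat := length (all_forests n).

Lemma num_forests_rec n :
  num_forests (3 + n) + num_forests n = 2 * num_forests (2 + n) + num_forests (1 + n).
Proof.
  unfold num_forests. change (3 + n) with (S (2 + n)). rewrite all_forests_S.
  rewrite indiv_forests_S. change (2 + n) with (S (1 + n)) at 3.
  rewrite indiv_forests_pred_S.
  (* The remaining [indiv_forests (S n)] is eliminated as the difference of two consecutive
     counts. *)
  pose proof (f_equal (@length _) (all_forests_S n)) as E.
  rewrite !length_app, !length_map in *. cbn [Nat.add] in *. lia.
Qed.

Lemma num_elements_forests n :
  num_elements (fun w => positive_elt w /\ word_length w n) (num_forests n).
Proof.
  destruct (in_enum n) as [E _]. destruct (NoDup_enum n) as [ND _].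
  set (real f := pos (forest_word f)).
  exists (map real (all_forests n)). split; [apply length_map |]. split; [| split].
  - apply Forall_map, Forall_forall. intros f Hf. apply E in Hf as [Hf Hw]. split.
    + apply positive_forest. now exists f.
    + now apply (word_length_forest _ f).
  - intros i j Hi Hj H. rewrite length_map in Hi, Hj.
    apply (proj1 (NoDup_nth _ trivial_forest) ND); [easy | easy |].
    apply reduced_forest_word_inj; [now apply E, nth_In | now apply E, nth_In |].
    (* The default value [[]] must be the image of a forest under [real] for [map_nth] to apply. *)
    change (@nil letter) with (real trivial_forest) in H. now rewrite !map_nth in H.
  - intros w [Hp Hl]. apply positive_forest in Hp as (f & Hf & Ef).
    exists (real f). split; [| easy]. apply in_map, E. split; [easy |].
    symmetry. now apply (word_length_forest w f).
Qed.

Lemma fold_right_add_0 l : Forall (fun z => z = 0%Z) l -> fold_right Z.add 0%Z l = 0%Z.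
Proof. induction 1 as [| z l -> _ IH]; cbn; lia. Qed.

Lemma fold_right_add_app l l' :
  fold_right Z.add 0%Z (l ++ l') = (fold_right Z.add 0 l + fold_right Z.add 0 l')%Z.
Proof. induction l as [| z l IH]; cbn [app fold_right]; lia. Qed.

Lemma conv_denom p n :
  conv p denom_coef (3 + n)
  = (Z.of_nat (p n) - Z.of_nat (p (1 + n)%nat) - 2 * Z.of_nat (p (2 + n)%nat)
     + Z.of_nat (p (3 + n)%nat))%Z.
Proof.
  (* The denominator has degree 3, so only the last four summands survive. *)
  unfold conv. replace (S (3 + n)) with (n + 4) by lia.
  rewrite seq_app, map_app, fold_right_add_app, fold_right_add_0.
  - cbn [seq map fold_right Nat.add]. replace (S (S (S n)) - n) with 3 by lia.
    replace (S (S (S n)) - S n) with 2 by lia.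
    replace (S (S (S n)) - S (S n)) with 1 by lia.
    rewrite Nat.sub_diag. cbn [denom_coef]. lia.
  - apply Forall_map, Forall_forall. intros i Hi. apply in_seq in Hi.
    replace (3 + n - i) with (4 + (n - 1 - i)) by lia. cbn [denom_coef Nat.add]. lia.
Qed.

(* p n = number of positive elements of F of word length n;
   p(x) (1 - 2x - x^2 + x^3) = 1 - x^2 as formal power series
   (equivalently p(x) = (1-x^2)/(1-2x-x^2+x^3)), and the recurrence. *)
Theorem theorem5p2p1 :
  exists p : nat -> nat,
    (forall n, num_elements (fun w => positive_elt w /\ word_length w n) (p n)) /\
    (forall n, conv p denom_coef n = numer_coef n) /\
    (forall n, 3 <= n ->
       Z.of_nat (p n) = (2 * Z.of_nat (p (n - 1)%nat) + Z.of_nat (p (n - 2)%nat)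
                         - Z.of_nat (p (n - 3)%nat))%Z).
Proof.
  exists num_forests. split; [exact num_elements_forests |]. split.
  - intros [| [| [| n]]]; [reflexivity | reflexivity | reflexivity |].
    change (S (S (S n))) with (3 + n). rewrite conv_denom.
    pose proof (num_forests_rec n). cbn [numer_coef Nat.add] in *. lia.
  - intros n Hn. pose proof (num_forests_rec (n - 3)) as H.
    replace (3 + (n - 3)) with n in H by lia.
    replace (2 + (n - 3)) with (n - 1) in H by lia.
    replace (1 + (n - 3)) with (n - 2) in H by lia. lia.
Qed.
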